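(* Let $p$ be a prime, let $\mathcal F$ be a quasisaturated fusion system on a finite $p$-group $P$, and let $\mathfrak E$ be an essential collection. Let $Q,R\le P$ and let $\psi:Q\to R$ be an $\mathcal F$-isomorphism. Then there exist (a) a sequence of isomorphic subgroups $Q=Q_0,Q_1,\ldots,Q_n=R$ of $P$; (b) a sequence of subgroups $S_1,\ldots,S_n$ of $P$, where $S_i\in\mathfrak E$ or $S_i=P$, such that $Q_{i-1},Q_i\le S_i$ for $i=1,\ldots,n$; (c) $\psi_i\in\mathrm{Aut}_{\mathcal F}(S_i)$ such that $(Q_{i-1})\psi_i=Q_i$ for $i=1,\dots,n$ and $\psi=(\psi_1|_{Q_0})\circ(\psi_2|_{Q_1})\circ\cdots\circ(\psi_n|_{Q_{n-1}})$ (maps are written on the right, so $\psi_1$ is applied first).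
   Context: All groups are finite and maps are written on the right. Fusion systems on finite $p$-groups are understood in the standard sense (not assumed saturated). Let $\mathcal F$ be a fusion system on a $p$-group $P$. $Q^{\mathcal F}$ denotes the set of $\mathcal F$-conjugates of $Q$; $c_x$ denotes conjugation by $x$. For $Q\le P$ and $\phi\in\mathrm{Hom}_{\mathcal F}(Q,P)$, put $$N_\phi(Q)=\{x\in N_P(Q)\mid \exists\, y\in N_P(Q\phi)\text{ such that }\phi^{-1}c_x\phi=c_y\text{ on }Q\phi\}.$$ $Q\le P$ is receptive if every $\mathcal F$-isomorphism $\phi:R\to Q$ extends to some $\overline\phi\in\mathrm{Hom}_{\mathcal F}(N_\phi(R),P)$. A proper subgroup $R<P$ is reproductive, written $R\in\mathcal F^r$, if (a) $R$ is receptive, and (b) for each $Q\in R^{\mathcal F}$ there exists $\psi\in\mathrm{Hom}_{\mathcal F}(Q,R)$ with $N_\psi(Q)>Q$. $\mathcal F$ is quasisaturated if each proper subgroup of $P$ has an $\mathcal F$-conjugate lying in $\mathcal F^r$. A subgroup $Q\leq P$ is $\mathcal F$-essential if $Q\in\mathcal F^r$ and $H_Q=\langle\phi\in\mathrm{Aut}_{\mathcal F}(Q)\mid N_\phi(Q)>Q\rangle$ is proper in $\mathrm{Aut}_{\mathcal F}(Q)$. For a collection $\mathfrak V$ of subgroups of $P$, a subset $\mathfrak U\subseteq\mathfrak V$ is an $\mathcal F$-conjugacy representative of $\mathfrak V$ if each member of $\mathfrak V$ has exactly one $\mathcal F$-conjugate in $\mathfrak U$. A subset $\mathfrak E\subseteq\mathcal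 F^r$ is an essential collection if there is an $\mathcal F$-conjugacy representative $\mathfrak U$ of $\mathcal F^r$ such that $\mathfrak E=\{Q\in\mathfrak U\mid Q\text{ is }\mathcal F\text{-essential}\}$. *)

(* Defs.v *)
From mathcomp Require Import all_boot all_fingroup all_solvable.

Set Implicit Arguments.
Unset Strict Implicit.
Unset Printing Implicit Defensive.

Local Open Scope group_scope.

Section FusionSystem.

Variable gT : finGroupType.
Implicit Types (P Q R S T : {group gT}) (f g : {ffun gT -> gT}).

(* A homomorphism with domain Q is encoded by any function on the ambient type
   whose restriction to Q is that homomorphism; values outside Q are
   irrelevant (see fs_ext below). *)
Definition cat_iso (hom : {group gT} -> {group gT} -> {set {ffun gT -> gT}})
    Q R : {set {ffun gT -> gT}} :=
  [set f in hom Q R | [exists g in hom R Q,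
     [forall x in Q, g (f x) == x] && [forall y in R, f (g y) == y]]].

(* A category whose objects are the subgroups of P, with
   Hom_P(Q, R) <= Hom_F(Q, R) <= Inj(Q, R), in which every morphism is an
   isomorphism of the category followed by an inclusion.  Identities and
   inclusions are the case x = 1 of fs_conj. *)
Record fusion_system P := FusionSystem {
  FHom : {group gT} -> {group gT} -> {set {ffun gT -> gT}};
  fs_obj : forall Q R f, f \in FHom Q R -> (Q \subset P) && (R \subset P);
  fs_ext : forall Q R f g, {in Q, f =1 g} -> f \in FHom Q R -> g \in FHom Q R;
  fs_inj : forall Q R f, f \in FHom Q R ->
    [/\ {in Q &, {morph f : x y / x * y}}, {in Q &, injective f}
      & f @: Q \subset R];
  fs_conj : forall Q R x, Q \subset P -> R \subset P -> x \in P ->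
    Q :^ x \subset R -> [ffun u => u ^ x] \in FHom Q R;
  fs_comp : forall Q R S f g, f \in FHom Q R -> g \in FHom R S ->
    [ffun u => g (f u)] \in FHom Q S;
  fs_factor : forall Q R f, f \in FHom Q R ->
    exists2 T : {group gT}, T \subset R & f \in cat_iso FHom Q T
}.

Variables (P : {group gT}) (F : fusion_system P).

Definition FIso Q R : {set {ffun gT -> gT}} := cat_iso (FHom F) Q R.

(* {perm gT} composes from left to right, i.e. permutations act on the right. *)
Definition FAut Q : {set {perm gT}} :=
  [set a in Aut Q | [ffun x => a x] \in FHom F Q Q].

Definition Fconjugates Q : {set {group gT}} :=
  [set R : {group gT} | FIso Q R != set0].

(* With maps on the right, f^-1 c_x f = c_y on Q f says that
   (u ^ x) f = (u f) ^ y for all u in Q. *)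
Definition Nphi f Q : {set gT} :=
  [set x in 'N_P(Q) | [exists y in 'N_P(f @: Q),
     [forall u in Q, f (u ^ x) == f u ^ y]]].

(* Nphi f R is a subgroup whenever f is a morphism on R; N is that subgroup. *)
Definition receptive Q : bool :=
  (Q \subset P) &&
  [forall R : {group gT}, forall f in FIso R Q,
     [exists N : {group gT}, (N == Nphi f R :> {set gT}) &&
        [exists g in FHom F N P, [forall x in R, g x == f x]]]].

Definition reproductive : {set {group gT}} :=
  [set R : {group gT} | [&& R \proper P, receptive R &
     [forall Q in Fconjugates R,
        [exists f in FHom F Q R, Q \proper Nphi f Q]]]].

Definition quasisaturated : Prop :=
  forall Q, Q \proper P ->
    exists2 R : {group gT}, R \in Fconjugates Q & R \in reproductive.

Definition essential_aut Q : {group {perm gT}} :=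
  <<[set a in FAut Q | Q \proper Nphi [ffun x => a x] Q]>>%G.

Definition essential Q : bool :=
  (Q \in reproductive) && (essential_aut Q \proper FAut Q).

Definition conjugacy_representative (U V : {set {group gT}}) : Prop :=
  U \subset V /\ {in V, forall Q, #|Fconjugates Q :&: U| = 1%N}.

Definition essential_collection (E : {set {group gT}}) : Prop :=
  exists2 U : {set {group gT}}, conjugacy_representative U reproductive
    & E = [set Q in U | essential Q].

End FusionSystem.

(* Main.v *)
(* Induction on the index of Q.  If Q is proper, pick T in the conjugacy
   representative conjugate to Q.  Reproductivity gives isomorphisms
   g : Q -> T and h : R -> T that extend to strictly larger subgroups, where
   induction applies; so psi = g a h^-1 reduces to a in Aut_F(T).  If T is
   essential, a is a single step of the chain; otherwise a is a product of
   automorphisms of T which again extend to strictly larger subgroups. *)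

Require Import Defs.
From mathcomp Require Import all_boot all_fingroup all_solvable.

Set Implicit Arguments.
Unset Strict Implicit.
Unset Printing Implicit Defensive.

Local Open Scope group_scope.

(** * Isomorphisms and automorphism groups in a fusion system *)

Section Isomorphisms.

Variables (gT : finGroupType) (P : {group gT}) (F : fusion_system P).
Implicit Types (Q R S T : {group gT}) (f g : {ffun gT -> gT}) (a : {perm gT}).

Lemma FIso_FHom Q R f : f \in FIso F Q R -> f \in FHom F Q R.
Proof. by rewrite inE => /andP[]. Qed.

Lemma FIso_inv Q R f : f \in FIso F Q R ->
  exists2 g, g \in FIso F R Q & {in Q, cancel f g}.
Proof.
rewrite inE => /andP[Ff /existsP[g /and3P[Fg /forall_inP fK /forall_inP gK]]].
exists g => [|x Qx]; last exact/eqP/fK.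
rewrite inE Fg; apply/existsP; exists f; rewrite Ff /=.
by apply/andP; split; apply/forall_inP.
Qed.

Lemma FIso_im Q R f : f \in FIso F Q R -> f @: Q = R.
Proof.
rewrite inE => /andP[Ff /existsP[g /and3P[Fg _ /forall_inP gK]]].
have [_ _ sfR] := fs_inj Ff; have [_ _ sgQ] := fs_inj Fg.
apply/eqP; rewrite eqEsubset sfR; apply/subsetP=> y Ry.
rewrite -(eqP (gK y Ry)); apply/imset_f/(subsetP sgQ)/imset_f/Ry.
Qed.

Lemma FIso_card Q R f : f \in FIso F Q R -> #|R| = #|Q|.
Proof.
move=> If; have [_ injf _] := fs_inj (FIso_FHom If).
by rewrite -(FIso_im If) card_in_imset.
Qed.

(** By [fs_factor], [f] is an isomorphism onto some subgroup of [R], and the order bound forces this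
    subgroup to be all of [R]. *)
Lemma FHom_FIso Q R f : f \in FHom F Q R -> #|R| <= #|Q| -> f \in FIso F Q R.
Proof.
move=> Ff leRQ; have [T sTR If] := fs_factor Ff.
suffices <-: T = R by [].
by apply/val_inj/eqP; rewrite eqEcard sTR (FIso_card If).
Qed.

Lemma FIso_comp Q R S f g : f \in FIso F Q R -> g \in FIso F R S ->
  [ffun x => g (f x)] \in FIso F Q S.
Proof.
move=> If Ig; apply: FHom_FIso.
  exact: fs_comp (FIso_FHom If) (FIso_FHom Ig).
by rewrite (FIso_card Ig) (FIso_card If).
Qed.

Lemma group_set_FAut Q : Q \subset P -> group_set (FAut F Q).
Proof.
move=> sQP; apply/group_setP; split.
  apply/setIdP; split; first exact: group1.
  apply: (fs_ext (f := [ffun x => x ^ 1])).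
    by move=> x _; rewrite !ffunE conjg1 perm1.
  by apply: fs_conj; rewrite ?group1 ?conjsg1.
move=> a b /setIdP[Aa Fa] /setIdP[Ab Fb]; apply/setIdP; split.
  exact: groupM.
by apply: fs_ext (fs_comp Fa Fb) => x _; rewrite !ffunE permM.
Qed.

Lemma FAutV Q a : Q \subset P -> a \in FAut F Q -> a^-1 \in FAut F Q.
Proof.
by move=> sQP; have := @groupVr _ (Group (group_set_FAut sQP)) a; apply.
Qed.

Lemma FAut_FIso Q a : a \in FAut F Q -> [ffun x => a x] \in FIso F Q Q.
Proof. by rewrite inE => /andP[_ Fa]; apply: FHom_FIso. Qed.

(** The values of [f] outside [Q] are arbitrary, whereas [Aut Q] asks for a permutation fixing every
    point outside [Q]; [perm_in] supplies it and [fs_ext] keeps it in the system. *)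
Lemma FIso_FAut Q f : f \in FIso F Q Q ->
  exists2 a, a \in FAut F Q & {in Q, f =1 a}.
Proof.
move=> If; have Ff := FIso_FHom If; have [fM injf sfQ] := fs_inj Ff.
have aE := perm_inE injf sfQ.
exists (perm_in injf sfQ) => [|x Qx]; last by rewrite aE.
rewrite inE; apply/andP; split; last first.
  by apply: fs_ext Ff => x Qx; rewrite ffunE aE.
rewrite inE perm_in_on; apply/morphicP=> x y Qx Qy.
by rewrite !aE ?groupM // fM.
Qed.

Lemma Aut_imset_isog S Q a : a \in Aut S -> Q \subset S ->
  exists2 T : {group gT}, a @: Q = T & Q \isog T.
Proof.
move=> Aa sQS; exists (autm Aa @* Q)%G.
  by rewrite /= morphimEsub //; apply: eq_imset => x; rewrite autmE.
exact: sub_isog (injm_autm Aa).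
Qed.

End Isomorphisms.

(** * Chains of automorphisms of members of [E] and of [P] *)

Section Chains.

Variables (gT : finGroupType) (P : {group gT}) (F : fusion_system P).
Variable E : {set {group gT}}.
Implicit Types (Q R S T : {group gT}) (f g : gT -> gT) (a b : {perm gT}).

Definition step Q T S a : Prop :=
  [/\ S \subset P, S \in E \/ S = P, Q \subset S, T \subset S
    & a \in FAut F S /\ a @: Q = T].

(** The last index is the composite of the chain as one permutation of the whole ambient type, so
    that concatenating, reversing and restricting chains become computations with products and
    inverses. *)
Inductive chain : {group gT} -> {group gT} -> {perm gT} -> Prop :=
| chain_nil Q of Q \subset P : chain Q Q 1
| chain_cons Q T R S a b of step Q T S a & chain T R b : chain Q R (a * b).

Lemma chain_step Q T S a : step Q T S a -> chain Q T a.
Proof.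
move=> st; rewrite -[a]mulg1; apply: chain_cons (st) _; apply: chain_nil.
by case: st => sSP _ _ sTS _; apply: subset_trans sSP.
Qed.

Lemma chain_cat Q T R a b : chain Q T a -> chain T R b -> chain Q R (a * b).
Proof.
elim=> [{}Q _ | {}Q T1 {}T S a1 {}a st _ IH /IH]; first by rewrite mul1g.
by rewrite -mulgA; apply: chain_cons st.
Qed.

Lemma chain_im Q R b : chain Q R b -> b @: Q = R.
Proof.
elim=> [{}Q _ | {}Q T {}R S a {}b [_ _ _ _ [_ aQ]] _ <-].
  by rewrite -[RHS]imset_id; apply: eq_imset => x; rewrite perm1.
by rewrite -aQ -imset_comp; apply: eq_imset => x; rewrite permM.
Qed.

Lemma stepV Q T S a : step Q T S a -> step T Q S a^-1.
Proof.
case=> sSP ES sQS sTS [Fa aQ]; split=> //; split; first exact: FAutV.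
rewrite -aQ -imset_comp -[RHS]imset_id; apply: eq_imset => x /=.
by rewrite permK.
Qed.

Lemma chainV Q R b : chain Q R b -> chain R Q b^-1.
Proof.
elim=> [{}Q sQP | {}Q T {}R S a {}b st _ IH].
  by rewrite invg1; apply: chain_nil.
by rewrite invMg; apply: chain_cat IH (chain_step (stepV st)).
Qed.

(** The same [S] and the same automorphisms serve; only the intermediate subgroups shrink, to the
    successive images of [Q1]. *)
Lemma chain_restrict Q R b : chain Q R b -> forall Q1 R1 : {group gT},
  Q1 \subset Q -> b @: Q1 = R1 -> chain Q1 R1 b.
Proof.
elim=> [{}Q sQP | {}Q T {}R S a {}b [sSP ES sQS sTS [Fa aQ]] _ IH]
  Q1 R1 sQ1 bQ1.
  suffices <-: Q1 = R1 by apply: chain_nil; apply: subset_trans sQP.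
  apply/val_inj; rewrite /= -bQ1 -[LHS]imset_id.
  by apply: eq_imset => x; rewrite perm1.
have [Aa _] := setIdP Fa.
have [T1 aQ1 _] := Aut_imset_isog Aa (subset_trans sQ1 sQS).
have sT1: T1 \subset T by rewrite -aQ1 -aQ imsetS.
apply: (@chain_cons Q1 T1 R1 S).
  by split=> //; [apply: subset_trans sQS | apply: subset_trans sTS].
apply: IH => //; rewrite -aQ1 -bQ1 -imset_comp.
by apply: eq_imset => x; rewrite permM.
Qed.

Lemma step_isog Q T S a : step Q T S a -> Q \isog T.
Proof.
case=> _ _ sQS _ [/setIdP[Aa _] aQ].
have [T1 aQ1 isoQ] := Aut_imset_isog Aa sQS.
by rewrite -aQ aQ1.
Qed.

Lemma chain_seq Q R b : chain Q R b ->
  exists (n : nat) (Qs S : nat -> {group gT}) (phi : nat -> {perm gT}),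
    [/\ Qs 0 = Q, Qs n = R, forall i, i <= n -> Qs i \subset P /\ Q \isog Qs i,
        forall i, i < n -> step (Qs i) (Qs i.+1) (S i) (phi i)
      & b = \prod_(i < n) phi i].
Proof.
elim=> [{}Q sQP
  | {}Q T {}R S a {}b st _ [n [Qs [Ss [phi [Q0 Qn sQs stQs ->]]]]]].
  (* Only the value of the first sequence at 0 matters here; the rest are default values. *)
  exists 0, (fun=> Q), (fun=> Q), (fun=> 1).
  by split=> [||i _||]; rewrite ?isog_refl ?big_ord0.
exists n.+1, (fun i => if i is j.+1 then Qs j else Q),
  (fun i => if i is j.+1 then Ss j else S),
  (fun i => if i is j.+1 then phi j else a).
split=> //.
- case=> [_ | i /sQs[sP iso]].
    by case: st => sSP _ sQS _ _; rewrite (subset_trans sQS) ?isog_refl.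
  by split=> //; apply: isog_trans (step_isog st) iso.
- by case=> [_ | i /stQs]; first rewrite Q0.
by rewrite big_ord_recl.
Qed.

(** * Decomposing isomorphisms by induction on the index *)

Definition decomposable Q R f : Prop :=
  exists2 b, chain Q R b & {in Q, f =1 b}.

Lemma decomposable_comp Q T R f g :
  decomposable Q T f -> decomposable T R g -> decomposable Q R (g \o f).
Proof.
move=> [a ca fE] [b cb gE]; exists (a * b); first exact: chain_cat ca cb.
by move=> x Qx; rewrite /= permM fE // gE // -(chain_im ca) imset_f.
Qed.

Lemma decomposable_inv Q R f g :
  decomposable Q R f -> {in Q, cancel f g} -> decomposable R Q g.
Proof.
move=> [b cb fE] fK; exists b^-1; first exact: chainV.
move=> y; rewrite -(chain_im cb) => /imsetP[x Qx ->].
by rewrite permK -fE // fK.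
Qed.

Lemma eq_decomposable Q R f g :
  {in Q, f =1 g} -> decomposable Q R f -> decomposable Q R g.
Proof. by move=> eqfg [b cb fE]; exists b => // x Qx; rewrite -eqfg ?fE. Qed.

Definition decomposable_above m : Prop :=
  forall Q R (f : {ffun gT -> gT}), m < #|Q| -> f \in FIso F Q R ->
  decomposable Q R f.

(** Receptivity extends [f] to its strictly larger group [Nphi P f Q], where the induction
    hypothesis yields a chain; restricting this chain to [Q] decomposes [f]. *)
Lemma receptive_decomposable Q T (f : {ffun gT -> gT}) :
  decomposable_above #|Q| -> receptive F T -> f \in FIso F Q T ->
  Q \proper Nphi P f Q -> decomposable Q T f.
Proof.
move=> IH /andP[_ /forallP/(_ Q)/forall_inP recT] If.
have /existsP[N /andP[/eqP <- /exists_inP[g Fg /forall_inP gE]]] := recT f If.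
(* The extension maps into [P]; cutting its codomain down to its image makes it an isomorphism, as
   the hypothesis requires. *)
move=> ltQN; have [T1 _ Ig] := fs_factor Fg.
have [b cb gb] := IH _ _ _ (proper_card ltQN) Ig.
have sQN := proper_sub ltQN.
have fb: {in Q, f =1 b}.
  by move=> x Qx; rewrite -(eqP (gE x Qx)) gb // (subsetP sQN).
exists b => //; apply: chain_restrict cb _ _ sQN _.
by rewrite -(FIso_im If); apply: eq_in_imset => x /fb.
Qed.

(** In a finite group, every element of a generated subgroup is a product of generators without
    inverses, and each generator here extends beyond [T]. *)
Lemma essential_aut_decomposable T a :
  decomposable_above #|T| -> receptive F T -> a \in essential_aut F T ->
  decomposable T T a.
Proof.
move=> IH recT /gen_prodgP[n [c Ac ->]].
elim: n c Ac => [|n IHn] c Ac.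
  rewrite big_ord0; exists 1 => //; apply: chain_nil.
  by case/andP: recT.
rewrite big_ord_recl; set b := \prod_i _.
apply: (@eq_decomposable _ _ (b \o [ffun x => c ord0 x])).
  by move=> x _; rewrite /= ffunE permM.
apply: (@decomposable_comp _ T); last exact: IHn.
have /setIdP[/FAut_FIso If ltT] := Ac ord0.
exact: receptive_decomposable.
Qed.

(** The map [f] only witnesses that [Q] is conjugate to [T]; clause (b) of reproductivity then
    provides a possibly different [g] with [Nphi P g Q] larger than [Q]. *)
Lemma reproductive_decomposable Q T (f : {ffun gT -> gT}) :
  decomposable_above #|Q| -> T \in reproductive F -> f \in FIso F Q T ->
  exists2 g : {ffun gT -> gT}, g \in FIso F Q T & decomposable Q T g.
Proof.
move=> IH + If; rewrite inE => /and3P[_ recT /forall_inP repT].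
have [f' If' _] := FIso_inv If.
have /repT/exists_inP[g Fg ltQ]: Q \in Fconjugates F T.
  by rewrite inE; apply/set0Pn; exists f'.
have Ig: g \in FIso F Q T by apply: FHom_FIso; rewrite ?(FIso_card If).
by exists g => //; apply: receptive_decomposable.
Qed.

(** Quasisaturation gives a reproductive conjugate of [Q], which in turn has a conjugate in [U]. *)
Lemma quasisaturated_conjugate U Q :
  quasisaturated F -> conjugacy_representative F U (reproductive F) ->
  Q \proper P ->
  exists2 T, T \in U & exists f : {ffun gT -> gT}, f \in FIso F Q T.
Proof.
move=> qsF [_ U1] /qsF[T1]; rewrite inE => /set0Pn[f If] repT1.
have: Fconjugates F T1 :&: U != set0 by rewrite -cards_eq0 U1.
case/set0Pn=> T; rewrite 2!inE => /andP[/set0Pn[g Ig] UT].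
by exists T => //; eexists; apply: FIso_comp If Ig.
Qed.

Lemma FIso_decomposable Q R (f : {ffun gT -> gT}) :
  quasisaturated F -> essential_collection F E -> f \in FIso F Q R ->
  decomposable Q R f.
Proof.
move=> qsF [U repU defE].
have [m] := ubnP (#|P| - #|Q|); elim: m => // m IHm in Q R f *.
rewrite ltnS => lem If; have /andP[sQP sRP] := fs_obj (FIso_FHom If).
(* If [Q = P], then [f] is an automorphism of [P], hence a single step with [S = P]. *)
have [eqQP | ltQP] := eqVproper sQP.
  have defQ: Q = P by apply: val_inj.
  have defR: R = P.
    by apply/val_inj/eqP; rewrite eqEcard sRP (FIso_card If) defQ /=.
  rewrite {}defQ {}defR in If *; have [a Fa fE] := FIso_FAut If.
  exists a => //; apply: (@chain_step _ _ P); split=> //; first by right.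
  by split=> //; rewrite -[RHS](FIso_im If); apply: eq_in_imset => x /fE.
have IH: decomposable_above #|Q|.
  move=> Q1 R1 f1 ltQ1 If1; apply: IHm (If1); apply: leq_trans lem.
  by rewrite ltn_sub2l // proper_card.
have [T UT [f0 If0]] := quasisaturated_conjugate qsF repU ltQP.
have repT: T \in reproductive F by case: repU => /subsetP->.
have [f' If' _] := FIso_inv If.
have [g Ig dg] := reproductive_decomposable IH repT If0.
(* [R] is conjugate to [T] through [Q], and the induction hypothesis carries over since [R] and [Q]
   have equal order. *)
have [h Ih dh] :
    exists2 h : {ffun gT -> gT}, h \in FIso F R T & decomposable R T h.
  apply: (reproductive_decomposable (f := [ffun x => f0 (f' x)])) => //.
    by rewrite (FIso_card If).
  exact: FIso_comp If' If0.
have [g' Ig' gK] := FIso_inv Ig.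
have [h' _ hK] := FIso_inv Ih.
have dh' := decomposable_inv dh hK.
(* This is g^-1 f h with maps on the right, an automorphism of [T]. *)
have Ik := FIso_comp (FIso_comp Ig' If) Ih.
have [a Fa kE] := FIso_FAut Ik.
suffices da: decomposable T T a.
  apply: eq_decomposable (decomposable_comp (decomposable_comp dg da) dh').
  have im (Q1 R1 : {group gT}) (f1 : {ffun gT -> gT}) x :
      f1 \in FIso F Q1 R1 -> x \in Q1 -> f1 x \in R1.
    by move=> I1 Q1x; rewrite -(FIso_im I1) imset_f.
  move=> x Qx; rewrite /= -kE ?(im _ _ _ _ Ig) // !ffunE gK // hK //.
  exact: im If Qx.
have recT: receptive F T by move: repT; rewrite inE => /and3P[].
have [essT | ] := boolP (essential F T).
  exists a => //; apply: (@chain_step _ _ T).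
  split=> //; first by case/andP: recT.
    by left; rewrite defE inE UT.
  split=> //; rewrite -[RHS](FIso_im Ik).
  by apply: eq_in_imset => x /kE.
(* As [T] is reproductive, it can fail to be essential only if [essential_aut F T] is not proper in
   [FAut F T]; being contained in it, it is then all of it. *)
rewrite /essential repT /= properE negb_and negbK.
have sgen: essential_aut F T \subset FAut F T.
  case/andP: recT => sTP _.
  rewrite -[FAut F T]/(gval (Group (group_set_FAut F sTP))) gen_subG.
  by apply/subsetP=> b /setIdP[].
rewrite sgen /= => /subsetP sFA; apply: essential_aut_decomposable => //.
  by rewrite (FIso_card If0).
exact: sFA.
Qed.

End Chains.

Theorem theorem3p5 (gT : finGroupType) (p : nat) (P : {group gT})
    (F : fusion_system P) (E : {set {group gT}})
    (Q R : {group gT}) (psi : {ffun gT -> gT}) :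
  prime p -> p.-group P -> quasisaturated F -> essential_collection F E ->
  Q \subset P -> R \subset P -> psi \in FIso F Q R ->
  exists (n : nat) (Qs : 'I_n.+1 -> {group gT}) (S : 'I_n -> {group gT})
         (phi : 'I_n -> {perm gT}),
    [/\ Qs ord0 = Q, Qs ord_max = R,
        forall i : 'I_n.+1, Qs i \subset P /\ Q \isog Qs i,
        forall i : 'I_n,
          [/\ S i \subset P, S i \in E \/ S i = P,
              Qs (widen_ord (leqnSn n) i) \subset S i,
              Qs (lift ord0 i) \subset S i
            & phi i \in FAut F (S i) /\
              phi i @: Qs (widen_ord (leqnSn n) i) = Qs (lift ord0 i)]
      & {in Q, forall x, psi x = (\prod_(i < n) phi i) x}].
Proof.
move=> _ _ qsF essE _ _ Ipsi.
have [b cb psiE] := FIso_decomposable qsF essE Ipsi.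
have [n [Qs [S [phi [Q0 Qn sQs st bE]]]]] := chain_seq cb.
exists n, (fun i => Qs i), (fun i => S i), (fun i => phi i); split=> //.
- by move=> i; apply: sQs; rewrite -ltnS.
- by move=> i; apply: st.
by move=> x Qx; rewrite psiE // bE.
Qed.
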